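(* Let $H$ be a standard subspace of a complex separable Hilbert space $\mathcal H$ and let $U$ be a unitary on $\mathcal H$ with $UH\subsetneq H$ (a proper endomorphism of $H$). Let $B_U:=U^*\Delta_H^{1/2}$ with domain $\operatorname{dom}\Delta_H^{1/2}$, and $n_U^\pm:=\dim\ker(B_U^*\mp i)$. (a) If $U$ is symmetric, i.e. $U=J_HU^*J_H$, then $$\dim\left((UH)^{\perp_{\mathbb R}}\cap H\right)\ \ge\ n_U^++n_U^->0.$$ (b) If $U=V^2$ with a symmetric endomorphism $V$ of $H$ (i.e. $V$ unitary, $VH\subset H$, $V=J_HV^*J_H$), then $n_U^+=n_U^-$ and $$\dim\left((UH)'\cap H\right)\ \ge\ n_U^+>0.$$ In particular, the inclusion $UH\subset H$ is not singular in this case, i.e. $(UH)'\cap H\neq\{0\}$.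
   Context: Inner products are linear in the second argument. A standard subspace of $\mathcal H$ is a closed real linear subspace $H$ with $H+iH$ dense and $H\cap iH=\{0\}$. $X'=\{v\in\mathcal H:\operatorname{Im}\langle v,x\rangle=0\ \forall x\in X\}$ is the symplectic complement and $X^{\perp_{\mathbb R}}=iX'$ the orthogonal complement with respect to $\operatorname{Re}\langle\cdot,\cdot\rangle$. The Tomita operator $S_H:H+iH\to H+iH$, $h_1+ih_2\mapsto h_1-ih_2$, has polar decomposition $S_H=J_H\Delta_H^{1/2}$, with modular conjugation $J_H$ (antiunitary involution) and modular operator $\Delta_H$. Dimensions of real subspaces such as $(UH)'\cap H$ are real dimensions, those of complex subspaces such as $\ker(B_U^*\mp i)$ are complex dimensions; values may be infinite. *)

(* Defs.v *)
From HB Require Import structures.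
From mathcomp Require Import all_boot all_order all_algebra.
From mathcomp Require Import complex.
From mathcomp Require Import all_classical all_reals all_analysis.

Set Implicit Arguments.
Unset Strict Implicit.
Unset Printing Implicit Defensive.

Import Order.TTheory GRing.Theory Num.Theory.
Import numFieldNormedType.Exports.

Local Open Scope classical_set_scope.
Local Open Scope ring_scope.
Local Open Scope complex_scope.

(* The inner product is linear in its second argument; positive definiteness
   follows from [dot_norm] and the axioms of a norm. *)
HB.mixin Record isHilbert (R : realType) E of CompleteNormedModule R[i] E := {
  dot : E -> E -> R[i] ;
  dot_linear : forall x (a : R[i]) y z,
    dot x (a *: y + z) = a * dot x y + dot x z ;
  dot_conj : forall x y, dot y x = conjc (dot x y) ;
  dot_norm : forall x, dot x x = `|x| ^+ 2
}.

#[short(type="hilbertType")]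
HB.structure Definition Hilbert (R : realType) :=
  { E of CompleteNormedModule R[i] E & isHilbert R E }.

Definition separable_space (T : topologicalType) :=
  exists2 D : set T, countable D & dense D.

Section Subspaces.
Context {R : realType} {E : hilbertType R}.
Implicit Types (X H : set E).

Definition real_subspace X :=
  X 0 /\ forall (r : R) x y, X x -> X y -> X (r%:C *: x + y).

Definition mul_i X : set E := [set 'i *: x | x in X].

Definition complexification X : set E := [set x + 'i *: y | x in X & y in X].

Definition standard_subspace H :=
  [/\ real_subspace H, closed H, dense (complexification H) &
      H `&` mul_i H = [set 0]].

Definition symplectic_complement X : set E :=
  [set v | forall x, X x -> complex.Im (dot v x) = 0].

Definition real_orthogonal_complement X : set E :=
  [set v | forall x, X x -> complex.Re (dot v x) = 0].

Lemma real_orthogonal_complementE X :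
  real_orthogonal_complement X = mul_i (symplectic_complement X).
Proof.
have dotZl (a : R[i]) (v x : E) : dot (a *: v) x = conjc a * dot v x.
  rewrite dot_conj -[a *: v]addr0 dot_linear.
  have d0 : dot x 0 = 0.
    have := dot_linear x 1 0 0.
    by rewrite scale1r addr0 mul1r => /eqP; rewrite -subr_eq subrr => /eqP <-.
  by rewrite d0 addr0 rmorphM /= -dot_conj.
apply/seteqP; split => [v vX|_ [v vX <-] x Xx].
  exists (- 'i *: v); last first.
    by rewrite scalerA mulrN -expr2 sqr_i opprK scale1r.
  move=> x Xx; rewrite dotZl; have := vX x Xx.
  by case: (dot v x) => a b /= ->; rewrite !(oppr0, mulr0, mul0r, addr0, subr0).
rewrite dotZl; have := vX x Xx.
by case: (dot v x) => a b /= ->; rewrite !(oppr0, mulr0, mul0r, addr0, subr0).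
Qed.

(* [f] embeds the field of coefficients into the complex numbers. *)
Definition independent_over (K : pzRingType) (f : K -> R[i]) n
    (v : 'I_n -> E) :=
  forall c : 'I_n -> K, \sum_i f (c i) *: v i = 0 -> forall i, c i = 0.

(* The dimension of a subspace [X], with value [+oo] when it is infinite. *)
Definition dim_over (K : pzRingType) (f : K -> R[i]) X : \bar R :=
  ereal_sup [set (n%:R)%:E | n in [set n : nat |
    exists v : 'I_n -> E, (forall i, X (v i)) /\ independent_over f v]].

Definition real_dim : set E -> \bar R := dim_over (fun r : R => r%:C).

Definition complex_dim : set E -> \bar R := dim_over (fun z : R[i] => z).

End Subspaces.

(* An unbounded operator is represented by its graph, a set of pairs
   [(x, T x)] with [x] in the domain of [T].  Equality of graphs is equality of
   operators including their domains, and [T \; S] is the composition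
   [x |-> T (S x)] on its maximal domain. *)
Section Operators.
Context {R : realType} {E : hilbertType R}.
Implicit Types (T D B : set (E * E)) (U J : E -> E) (H : set E).

Definition graph U : set (E * E) := [set xy | xy.2 = U xy.1].

Definition domain T : set E := [set x | exists y, T (x, y)].

Definition linear_operator T :=
  [/\ T (0, 0),
      forall (a : R[i]) x y x' y', T (x, y) -> T (x', y') ->
        T (a *: x + x', a *: y + y') &
      forall x y y', T (x, y) -> T (x, y') -> y = y'].

Definition adjoint T : set (E * E) :=
  [set yz | forall x w, T (x, w) -> dot yz.1 w = dot yz.2 x].

Definition positive_selfadjoint T :=
  [/\ linear_operator T, dense (domain T), adjoint T = T &
      forall x y, T (x, y) -> 0 <= dot x y].

Definition unitary U :=
  [/\ forall (a : R[i]) x y, U (a *: x + y) = a *: U x + U y,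
      forall x y, dot (U x) (U y) = dot x y &
      forall y, exists x, U x = y].

Definition antiunitary_involution J :=
  [/\ forall (a : R[i]) x y, J (a *: x + y) = conjc a *: J x + J y,
      forall x y, dot (J x) (J y) = dot y x &
      forall x, J (J x) = x].

Definition tomita H : set (E * E) :=
  [set (h1 + 'i *: h2, h1 - 'i *: h2) | h1 in H & h2 in H].

Definition positive_sqrt D Dhalf :=
  positive_selfadjoint Dhalf /\ D = (Dhalf \; Dhalf)%relation.

(* The polar decomposition of the Tomita operator of [H]: modular conjugation
   [J], modular operator [Delta] and its square root [Dhalf].  These data are
   determined by [H], since polar decompositions are unique. *)
Definition modular_data H J Delta Dhalf :=
  [/\ antiunitary_involution J, positive_selfadjoint Delta,
      positive_sqrt Delta Dhalf &
      tomita H = (graph J \; Dhalf)%relation].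

Definition symmetric_wrt J U :=
  graph U = (graph J \; adjoint (graph U) \; graph J)%relation.

Definition endomorphism H U := unitary U /\ U @` H `<=` H.

Definition proper_endomorphism H U := unitary U /\ U @` H `<` H.

Definition BU U Dhalf : set (E * E) := (adjoint (graph U) \; Dhalf)%relation.

Definition ker_shift T (z : R[i]) : set E :=
  [set x | exists2 y, T (x, y) & y - z *: x = 0].

Definition deficiency_plus U Dhalf : \bar R :=
  complex_dim (ker_shift (adjoint (BU U Dhalf)) 'i).

Definition deficiency_minus U Dhalf : \bar R :=
  complex_dim (ker_shift (adjoint (BU U Dhalf)) (- 'i)).

End Operators.

(* Main.v *)
Require Import Defs.
From mathcomp Require Import all_boot all_order all_algebra.
From mathcomp Require Import complex.
From mathcomp Require Import all_classical all_reals all_analysis.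
From mathcomp Require Import ring lra.

Set Implicit Arguments.
Unset Strict Implicit.
Unset Printing Implicit Defensive.

Import Order.TTheory GRing.Theory Num.Theory.
Import numFieldNormedType.Exports.

Local Open Scope classical_set_scope.
Local Open Scope ring_scope.

(** Write [D] for the square root of the modular operator, so that the Tomita
operator is [J D], [h] lies in [H] iff [D h = J h], and [J D J = D^-1].  Since
[adjoint (BU U D) = D U], the kernel of [adjoint (BU U D) - z] is
[K_z = {x | D U x = z x}], the [deficiency_space] below.

Symmetry of [U] says that [J U] is an involution, and [U H] in [H] then turns
into [U^* D] being a restriction of [D U], i.e. [BU U D] is a symmetric operator
([modular_endo]).  For [|z| = 1] the antiunitary [x |-> conj z J U x] is a
conjugation of [K_z]; if [x] is one of its fixed points then
[h = U x] satisfies [D h = z x = J h], hence [h] is in [H], and moving [J] and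
[D] across the inner product gives [<h, U k> = z^2 conj <h, U k>] for [k] in [H]
([real_form_dot]).  Thus [z = i] and [z = -i] produce vectors of [H] which are
real orthogonal to [U H], while [z = -1] produces vectors of [H] in the
symplectic complement of [U H].  The fixed points of a conjugation of a complex
space have real dimension equal to its complex dimension, which gives the
inequality of (a), and reduces the one of (b) to comparing [K_i] with [K_-1].

For [U = V^2] this comparison is made by Moebius transforms of [D]
([complex_dim_square_le]).  If [x] is in [K_z] then [V x] formally satisfies
[D (V x) = z V x], although it need not be in the domain of [D].  The operator
[(D - w)^-1 (D - z)] is bounded when [w] is not a
nonnegative real, and applied to
[V x] it yields a vector which formally satisfies the same equation with [w] in
place of [z]; multiplied by [V^*] it is an honest element of [K_w].  Taking
[{z, w} = {i, -i}] gives the equality of the two deficiency indices, and [w = -1]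
gives the missing inequality.

For the strict positivity, suppose that [K_i] and [K_-i] vanish.  Then [BU U D]
is a closed symmetric operator with trivial deficiency spaces, hence it is
selfadjoint: [D U x = w] implies [D x = U w].  Applied to [U x = h] in [H] this
puts [x] in [H], so [U H = H], against the hypothesis that [U] is a proper
endomorphism ([deficiency_trivial_onto]).  Both this step and the invertibility
of [D - w] rest on the closed range argument [shift_surj], hence on the
projection onto a closed subspace [ex_projection]. *)

(** * The inner product *)

Section InnerProduct.
Local Open Scope complex_scope.
Context {R : realType} {E : hilbertType R}.
Implicit Types (x y z : E) (a : R[i]).

Lemma dotDr x y z : dot x (y + z) = dot x y + dot x z.
Proof. by have := dot_linear x 1 y z; rewrite scale1r mul1r. Qed.

Lemma dot0r x : dot x 0 = 0.
Proof. by apply: (addrI (dot x 0)); rewrite -dotDr !addr0. Qed.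

Lemma dotZr a x y : dot x (a *: y) = a * dot x y.
Proof. by rewrite -[a *: y]addr0 dot_linear dot0r addr0. Qed.

Lemma dotNr x y : dot x (- y) = - dot x y.
Proof. by rewrite -scaleN1r dotZr mulN1r. Qed.

Lemma dotBr x y z : dot x (y - z) = dot x y - dot x z.
Proof. by rewrite dotDr dotNr. Qed.

Lemma dotDl x y z : dot (x + y) z = dot x z + dot y z.
Proof. by rewrite dot_conj dotDr rmorphD /= -!dot_conj. Qed.

Lemma dotZl a x y : dot (a *: x) y = conjc a * dot x y.
Proof. by rewrite dot_conj dotZr rmorphM /= -!dot_conj. Qed.

Lemma dotNl x y : dot (- x) y = - dot x y.
Proof. by rewrite dot_conj dotNr rmorphN /= -!dot_conj. Qed.

Lemma dotBl x y z : dot (x - y) z = dot x z - dot y z.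
Proof. by rewrite dotDl dotNl. Qed.

Lemma dot0l x : dot 0 x = 0.
Proof. by rewrite dot_conj dot0r conjc0. Qed.

Lemma dot_ge0 x : 0 <= dot x x.
Proof. by rewrite dot_norm exprn_ge0. Qed.

Lemma dot_eq0 x : dot x x = 0 -> x = 0.
Proof.
by move=> /eqP; rewrite dot_norm expf_eq0 /= normr_eq0 => /eqP.
Qed.

Lemma dot_gt0 x : x <> 0 -> 0 < dot x x.
Proof.
by move=> /eqP x0; rewrite dot_norm exprn_gt0 // normr_gt0.
Qed.

(** Expand the square of [<y,y> x - <y,x> y]. *)
Lemma cauchy_schwarz x y : `|dot x y| <= `|x| * `|y|.
Proof.
have [->|/eqP/dot_gt0 y0] := eqVneq y 0; first by rewrite dot0r !normr0 mulr0.
rewrite -(@ler_pXn2r _ 2) ?nnegrE ?mulr_ge0 // exprMn -!dot_norm.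
have := dot_ge0 (dot y y *: x - dot y x *: y).
have cyy : conjc (dot y y) = dot y y by rewrite -dot_conj.
rewrite !(dotBl, dotBr, dotZl, dotZr) cyy -dot_conj sqr_normc -dot_conj.
rewrite [X in 0 <= X](_ : _ =
  dot y y * (dot x x * dot y y - dot x y * dot y x)); last by ring.
by rewrite pmulr_rge0 // subr_ge0.
Qed.

Lemma dot_cvgl (u : nat -> E) x y : u @ \oo --> x ->
  forall e : R[i], 0 < e -> \forall n \near \oo, `|dot x y - dot (u n) y| < e.
Proof.
move=> ux e e0.
have e0' : 0 < e / (`|y| + 1) by rewrite divr_gt0 // ltr_wpDl.
move/cvgrPdist_lt : ux => /(_ _ e0'); apply: filterS => n.
rewrite ltr_pdivlMr ?ltr_wpDl // -dotBl => h.
apply: le_lt_trans h; apply: le_trans (cauchy_schwarz _ _) _.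
by rewrite ler_wpM2l // lerDl.
Qed.

(** Sequences suffice here: the projection theorem only takes limits of minimizing
sequences. *)
Definition seq_closed_graph (T : set (E * E)) :=
  forall (u v : nat -> E) x y, (forall n, T (u n, v n)) ->
    u @ \oo --> x -> v @ \oo --> y -> T (x, y).

(** The graph of an adjoint is cut out by equations between inner products, which
are continuous. *)
Lemma adjoint_closed (T : set (E * E)) : seq_closed_graph (adjoint T).
Proof.
move=> u v x y Tuv ux vy a b Tab /=; apply/eqP; rewrite -subr_eq0.
apply/negPn/negP => /[dup] d0; rewrite -normr_gt0 => /(divr_gt0)/(_ (ltr0n _ 2)) e0.
have [n _ /(_ n (leqnn n))[]] : \forall n \near \oo,
  `|dot x b - dot (u n) b| < `|dot x b - dot y a| / 2 /\
  `|dot y a - dot (v n) a| < `|dot x b - dot y a| / 2.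
  by apply: filterI; apply: dot_cvgl.
rewrite (Tuv n a b Tab) /= => h1 h2; have := ltrD h1 h2.
rewrite -splitr => /lt_geF/negbT/negP; apply.
rewrite -[X in `|X| <= _](subrKA (dot (v n) a)).
by rewrite (le_trans (ler_normD _ _)) // lerD2l distrC.
Qed.

End InnerProduct.

(** * Projection onto a closed subspace *)

Section Projection.
Local Open Scope complex_scope.
Context {R : realType} {E : hilbertType R}.
Implicit Types (x y : E) (M : set E).

(** The norm of a space over [R[i]] takes its values in [R[i]], where the order is
partial; this real version is what infima and [lra] can work with. *)
Definition sqnorm x : R := complex.Re (dot x x).

Lemma dotxx x : dot x x = (sqnorm x)%:C.
Proof. by rewrite [RHS]RRe_real // ger0_real // dot_ge0. Qed.

Lemma sqnorm_ge0 x : 0 <= sqnorm x.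
Proof. by rewrite -ler0c -dotxx dot_ge0. Qed.

Lemma sqnormD x y :
  sqnorm (x + y) = sqnorm x + 2 * complex.Re (dot x y) + sqnorm y.
Proof.
rewrite /sqnorm dotDl !dotDr (dot_conj x y).
by case: (dot x y) (dot x x) (dot y y) => a b [? ?] [? ?] /=; ring.
Qed.

Lemma sqnormZ (r : R) x : sqnorm (r%:C *: x) = r ^+ 2 * sqnorm x.
Proof.
rewrite /sqnorm dotZl dotZr conjc_real.
by case: (dot x x) => a b /=; ring.
Qed.

Lemma sqnormN x : sqnorm (- x) = sqnorm x.
Proof. by rewrite /sqnorm dotNl dotNr opprK. Qed.

Lemma ReN (a : R[i]) : complex.Re (- a) = - complex.Re a.
Proof. by case: a. Qed.

Lemma norm_lt_sqnorm x (e : R) : 0 < e -> (`|x| < e%:C) = (sqnorm x < e ^+ 2).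
Proof.
move=> e0; rewrite -ltcR -dotxx dot_norm rmorphXn /= ltr_pXn2r // nnegrE //.
by rewrite ler0c ltW.
Qed.

Definition seq_closed M := forall (u : nat -> E) x,
  (forall n, M (u n)) -> u @ \oo --> x -> M x.

Lemma cauchy_seq_cvg (u : nat -> E) :
  (forall e : R[i], 0 < e -> exists N, forall n, (N <= n)%N -> `|u N - u n| < e) ->
  cvg (u @ \oo).
Proof.
move=> cu; apply: cauchy_cvg; apply: cauchy_exP => e e0.
have [N hN] := cu e e0; exists (u N); exists N => // n /= Nn.
by rewrite -ball_normE /=; exact: hN.
Qed.

(** A minimizing sequence is Cauchy by the parallelogram identity applied to [x - y n]
and [x - y m], since their midpoint is again at distance at least the infimum.
Orthogonality comes from passing to the limit in the inequality which says that
[y n] is nearly minimal in the direction [m]. *)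
Lemma ex_projection M x : real_subspace M -> seq_closed M ->
  exists2 y, M y & forall m, M m -> complex.Re (dot (x - y) m) = 0.
Proof.
move=> [M0 ML] Mcl.
pose S := [set sqnorm (x - y) | y in M].
have S0 : has_inf S.
  split; first by exists (sqnorm (x - 0)), 0.
  by exists 0 => _ [y _ <-]; exact: sqnorm_ge0.
have Sle y : M y -> inf S <= sqnorm (x - y).
  by move=> My; apply: ge_inf; [exact: S0.2 | exists y].
have near_inf (n : nat) : exists y, M y /\ sqnorm (x - y) < inf S + n.+1%:R^-1.
  have n0 : 0 < n.+1%:R^-1 :> R by rewrite invr_gt0 ltr0n.
  by have [_ [y My <-] ylt] := inf_adherent n0 S0; exists y.
have [y /all_and2[My ylt]] := choice near_inf.
have inv_le N n : (N <= n)%N -> n.+1%:R^-1 <= N.+1%:R^-1 :> R.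
  by move=> Nn; rewrite lef_pV2 ?posrE ?ltr0n // ler_nat ltnS.
have yclose N n : (N <= n)%N -> sqnorm (y N - y n) < 4 * N.+1%:R^-1.
  move=> Nn.
  have -> : y N - y n = (x - y n) - (x - y N) by rewrite opprB [RHS]addrC subrKA.
  have := Sle _ (ML 2^-1 _ _ (ML 1 _ _ (My N) (My n)) M0).
  have -> : x - (2^-1%:C *: (1%:C *: y N + y n) + 0) =
            2^-1%:C *: ((x - y n) + (x - y N)).
    rewrite scale1r addr0 addrACA -opprD scalerBr [y n + _]addrC; congr (_ - _).
    rewrite -{2 3}[x]scale1r -scalerDl scalerA.
    have -> : 1 + 1 = (2 : R)%:C :> R[i] by rewrite rmorph_nat.
    by rewrite -rmorphM mulVf ?scale1r // pnatr_eq0.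
  have := ylt N; have := lt_le_trans (ylt n) (lerD (lexx _) (inv_le _ _ Nn)).
  move: (x - y n) (x - y N) => p q; rewrite sqnormZ !sqnormD sqnormN dotNr ReN.
  have -> : (2^-1 : R) ^+ 2 = 4^-1 by field.
  move: (sqnorm p) (sqnorm q) (complex.Re _) (inf S) (N.+1%:R^-1) => *.
  lra.
have ycvg : cvg (y @ \oo).
  apply: cauchy_seq_cvg => -[e e']; rewrite ltcE /= => /andP[/eqP-> e0].
  have [N hN] : exists N, 4 * N.+1%:R^-1 < e ^+ 2.
    exists (Num.truncn (4 / e ^+ 2)).
    by rewrite ltr_pdivrMr ?ltr0n // mulrC -ltr_pdivrMr ?exprn_gt0 // truncnS_gt.
  exists N => n Nn.
  by rewrite (_ : e +i* 0 = e%:C) // norm_lt_sqnorm // (lt_trans (yclose _ _ Nn)).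
exists (lim (y @ \oo)); first exact: Mcl My ycvg.
move=> m Mm; set c := complex.Re _.
(* Minimality in the direction [r m], with an error [d] that absorbs both the defect
   of [y n] from being minimal and its distance to the limit. *)
have bound (r : R) : 2 * r * c <= r ^+ 2 * sqnorm m.
  apply/ler_addgt0Pr; move=> /= d d0.
  have e0 : 0 < (d / (2 * (2 * `|r| + 1)))%:C.
    by rewrite ltcR divr_gt0 // mulr_gt0 // ltr_wpDl // mulr_ge0.
  have [N _ hN] := dot_cvgl m ycvg e0.
  pose n := maxn N (Num.truncn (2 / d)).
  have nd : n.+1%:R^-1 < d / 2.
    rewrite -[d / 2]invf_div ltf_pV2 ?posrE ?ltr0n ?divr_gt0 //.
    by rewrite (lt_le_trans (truncnS_gt _)) // ler_nat ltnS leq_maxr.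
  have /= := hN n (leq_maxl _ _).
  have := Sle _ (ML r _ _ Mm (My n)).
  rewrite [x - _](_ : _ = (x - y n) + (- r)%:C *: m); last first.
    by rewrite opprD rmorphN scaleNr addrCA addrC.
  rewrite sqnormD sqnormZ dotZr sqrrN.
  have -> : complex.Re ((- r)%:C * dot (x - y n) m) =
            - r * complex.Re (dot (x - y n) m).
    by case: (dot _ _) => ? ? /=; rewrite mul0r subr0.
  move=> h1 /(le_lt_trans (normc_ge_Re _)); rewrite ltcR => h2.
  have {h2} : `|c - complex.Re (dot (x - y n) m)| < d / (2 * (2 * `|r| + 1)).
    apply: le_lt_trans h2; rewrite /c !dotBl distrC.
    case: (dot x m) (dot (y n) m) (dot (lim _) m) => a ? [b ?] [b' ?] /=.
    by have -> : a - b - (a - b') = b' - b by ring.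
  have := ylt n; move: h1 nd.
  move: (complex.Re (dot (x - y n) m)) => cn h1 nd h3.
  rewrite ltr_pdivlMr; last by rewrite mulr_gt0 // ltr_wpDl // mulr_ge0.
  move=> h4.
  have : 2 * (r * (c - cn)) <= d / 2.
    apply: le_trans (_ : 2 * (`|r| * `|c - cn|) <= _).
      by rewrite ler_pM2l // -normrM ler_norm.
    have := normr_ge0 (c - cn); have := normr_ge0 r; lra.
  move: (n.+1%:R^-1) (sqnorm _) h1 nd h3 => i s h1 nd h3; lra.
(* This [r] is close to the optimal [c / sqnorm m], and avoids dividing by zero. *)
have := bound (c / (sqnorm m + 1)).
have s1 : 0 < sqnorm m + 1 by rewrite ltr_wpDl // sqnorm_ge0.
move=> h; have : (c / (sqnorm m + 1)) ^+ 2 * (sqnorm m + 2) <= 0.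
  rewrite -subr_ge0; move: h; rewrite -subr_ge0.
  congr (0 <= _); field; exact: lt0r_neq0.
rewrite pmulr_lle0 ?ltr_wpDl ?sqnorm_ge0 // => h0.
have /eqP : (c / (sqnorm m + 1)) ^+ 2 = 0 by apply/le_anti; rewrite h0 sqr_ge0.
by rewrite sqrf_eq0 mulf_eq0 invr_eq0 (gt_eqF s1) orbF => /eqP.
Qed.

End Projection.

(** * Surjectivity of shifted operators *)

Section Range.
Local Open Scope complex_scope.
Context {R : realType} {E : hilbertType R}.
Implicit Types (x y : E) (M : set E) (T : set (E * E)) (z : R[i]).

Lemma total_of_orthogonal M : real_subspace M -> seq_closed M ->
  (forall w, (forall m, M m -> complex.Re (dot w m) = 0) -> w = 0) ->
  forall x, M x.
Proof.
move=> Ms Mc Mw x; have [y My /Mw /eqP] := ex_projection x Ms Mc.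
by rewrite subr_eq0 => /eqP ->.
Qed.

(** [|y - z x|^2 = |y|^2 + |x|^2 - 2 Re (z <y, x>)] when [|z| = 1].  The hypothesis
holds for [y = T x] when [T] is symmetric and [z = i] or [-i], or [T] is positive
and [Re z <= 0]. *)
Lemma shift_norm_ge z x y : z * conjc z = 1 ->
  z * dot y x + conjc z * dot x y <= 0 -> `|x| <= `|y - z *: x|.
Proof.
move=> z1 h; rewrite -(@ler_pXn2r _ 2) ?nnegrE // -!dot_norm.
rewrite !(dotBl, dotBr, dotZl, dotZr) -subr_ge0.
rewrite [X in 0 <= X](_ : _ = dot y y + - (z * dot y x + conjc z * dot x y)
  + (z * conjc z - 1) * dot x x); last by ring.
by rewrite z1 subrr mul0r addr0 addr_ge0 ?dot_ge0 // oppr_ge0.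
Qed.

(** The range of [T - z] is closed because [T - z] is bounded below and [T] is
closed; its orthogonal complement is the kernel of [adjoint T - conj z]. *)
Lemma shift_surj T z : linear_operator T -> seq_closed_graph T ->
  (forall x y, T (x, y) -> `|x| <= `|y - z *: x|) ->
  (forall w, adjoint T (w, conjc z *: w) -> w = 0) ->
  forall u, exists x, T (x, u + z *: x).
Proof.
move=> [T0 TL _] Tcl Tge Tw u.
pose M := [set v | exists x, T (x, v + z *: x)].
suff : M u by [].
apply: total_of_orthogonal.
- split; first by exists 0; rewrite scaler0 addr0.
  move=> r v v' [x Tx] [x' Tx']; exists (r%:C *: x + x').
  rewrite scalerDr addrACA scalerA mulrC -scalerA -scalerDr.
  exact: TL.
- move=> v w Mv vw; have [x Tx] := choice Mv.
  have xdist m n : `|x m - x n| <= `|v m - v n|.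
    have := Tge _ _ (TL (- 1) _ _ _ _ (Tx n) (Tx m)).
    rewrite !scaleN1r ![- _ + _]addrC scalerBr => /le_trans; apply.
    by rewrite opprD addrACA addrK.
  have xcvg : cvg (x @ \oo).
    apply: cauchy_seq_cvg => e e0.
    have e2 : 0 < e / 2 by rewrite divr_gt0.
    move/cvgrPdist_lt : vw => /(_ _ e2)[N _ hN]; exists N => n Nn.
    apply: le_lt_trans (xdist _ _) _.
    rewrite -(subrKA w) [e]splitr (le_lt_trans (ler_normD _ _)) // ltrD //.
      by rewrite distrC; exact: hN (leqnn _).
    exact: hN.
  exists (lim (x @ \oo)); apply: (Tcl _ _ _ _ Tx xcvg).
  exact: (cvgD vw (cvgZl_tmp xcvg)).
move=> w wM; apply: Tw => x y Txy /=.
have ReM (a : R[i]) : complex.Re (a * dot w (y - z *: x)) = 0.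
  rewrite -dotZr; apply: wM; exists (a *: x).
  rewrite scalerBr scalerA mulrC -scalerA subrK -[a *: x]addr0 -[a *: y]addr0.
  exact: TL.
have : dot w (y - z *: x) = 0.
  have := ReM 1; have := ReM 'i; case: (dot _ _) => a b /=.
  by rewrite !(mul0r, mul1r, sub0r, subr0) => /eqP; rewrite oppr_eq0 => /eqP -> ->.
move/eqP; rewrite dotBr dotZr subr_eq0 => /eqP ->.
by rewrite dotZl conjcK.
Qed.

End Range.

(** * Dimensions *)

Section Dimension.
Local Open Scope complex_scope.
Context {R : realType} {E : hilbertType R}.
Implicit Types (K : pzRingType) (X Y Z : set E) (G : set (E * E)).

Lemma independent_in_le_dim K (f : K -> R[i]) X n (v : 'I_n -> E) :
  (forall i, X (v i)) -> independent_over f v -> ((n%:R)%:E <= dim_over f X)%E.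
Proof.
by move=> Xv vf; apply: ereal_sup_ubound; exists n => //; exists v.
Qed.

Lemma dim_le K (f : K -> R[i]) X (d : \bar R) :
  (forall n (v : 'I_n -> E), (forall i, X (v i)) -> independent_over f v ->
    ((n%:R)%:E <= d)%E) -> (dim_over f X <= d)%E.
Proof.
by move=> h; apply: ge_ereal_sup => _ [n [v [Xv vf]] <-]; exact: h Xv vf.
Qed.

Lemma le_dim K (f : K -> R[i]) X Y : X `<=` Y ->
  (dim_over f X <= dim_over f Y)%E.
Proof.
move=> XY; apply: dim_le => n v Xv; apply: independent_in_le_dim => i.
exact: XY.
Qed.

Lemma dim_ge0 K (f : K -> R[i]) X : (0 <= dim_over f X)%E.
Proof.
have v (i : 'I_0) : E by case: i.
by apply: (@independent_in_le_dim _ _ _ 0 v) => [[]|c _ []].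
Qed.

Lemma complex_dim_gt0 X x : X x -> x <> 0 -> (0 < complex_dim X)%E.
Proof.
move=> Xx /eqP x0; apply: lt_le_trans (_ : (1%:E <= _)%E); first by rewrite lte01.
apply: (@independent_in_le_dim _ _ _ 1 (fun=> x)) => // c.
rewrite big_ord1 => /eqP; rewrite scaler_eq0 (negPf x0) orbF => /eqP c0 i.
by rewrite ord1.
Qed.

Lemma real_dim_le0 X : (forall x, X x -> x = 0) -> (real_dim X <= 0)%E.
Proof.
move=> X0; apply: dim_le => -[|n] v Xv vf //.
have := vf (fun=> 1); rewrite big1; last first.
  by move=> i _; rewrite (X0 _ (Xv i)) scaler0.
by move=> /(_ erefl ord0) /eqP; rewrite oner_eq0.
Qed.

(** The injection is given by its graph [G], as the maps of use here are only
defined implicitly. *)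
Lemma dim_le_injection K (f : K -> R[i]) X Y G :
  (forall a x y x' y', G (x, y) -> G (x', y') -> G (f a *: x + x', f a *: y + y')) ->
  G (0, 0) -> (forall x, G (x, 0) -> x = 0) ->
  (forall x, X x -> exists2 y, Y y & G (x, y)) ->
  (dim_over f X <= dim_over f Y)%E.
Proof.
move=> GL G0 Ginj GX; apply: dim_le => n v Xv vf.
have [w /all_and2[Yw Gw]] := choice (fun i => let: ex_intro2 y Yy Gy :=
  GX _ (Xv i) in ex_intro (fun y => Y y /\ G (v i, y)) y (conj Yy Gy)).
apply: (independent_in_le_dim Yw) => c cw; apply: vf; apply: Ginj.
rewrite -[X in (_, X)]cw; elim/big_rec2: _ => // i y x _ Gxy; exact: GL.
Qed.

Lemma real_dim_add X Y Z : real_subspace X -> real_subspace Y ->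
  X `<=` Z -> Y `<=` Z -> X `&` Y `<=` [set 0] ->
  (real_dim X + real_dim Y <= real_dim Z)%E.
Proof.
move=> [X0 XL] [Y0 YL] XZ YZ XY.
have sum_in (A : set E) n (c : 'I_n -> R) (v : 'I_n -> E) : A 0 ->
    (forall r x y, A x -> A y -> A (r%:C *: x + y)) ->
    (forall i, A (v i)) -> A (\sum_i (c i)%:C *: v i).
  by move=> A0 AL Av; apply: (big_rec A) => // i x _; exact: AL.
suff add n (v : 'I_n -> E) m (w : 'I_m -> E) :
    (forall i, X (v i)) -> independent_over (real_complex R) v ->
    (forall i, Y (w i)) -> independent_over (real_complex R) w ->
    (n%:R%:E + m%:R%:E <= real_dim Z)%E.
  (* The two suprema are taken one after the other: addition cannot be moved across an
     inequality when the dimension of [Y] is infinite, but then the empty family of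
     [X] suffices. *)
  have addY n (v : 'I_n -> E) : (forall i, X (v i)) ->
      independent_over (real_complex R) v ->
      (n%:R%:E + real_dim Y <= real_dim Z)%E.
    move=> Xv vf; rewrite addeC -leeBrDr //; apply: dim_le => m w Yw wf.
    by rewrite leeBrDr // addeC; exact: (add n v m w).
  have Yge0 : (0 <= real_dim Y)%E by exact: dim_ge0.
  case dY : (real_dim Y) Yge0 addY => [d| |] // _ addY.
    rewrite -leeBrDr //; apply: dim_le => n v Xv vf; rewrite leeBrDr //.
    exact: (addY n v).
  have v (i : 'I_0) : E by case: i.
  have : (0%:R%:E + +oo <= real_dim Z)%E by apply: (addY 0%N v) => [[]|c _ []].
  by rewrite add0e leye_eq => /eqP ->; rewrite leey.
move=> Xv vf Yw wf.
pose t (i : 'I_(n + m)) := match fintype.split i with inl j => v j | inr j => w j end.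
have tl i : t (lshift m i) = v i by rewrite /t (unsplitK (inl _ i)).
have tr i : t (rshift n i) = w i by rewrite /t (unsplitK (inr _ i)).
rewrite -EFinD -natrD; apply: (@independent_in_le_dim _ _ _ _ t).
  by move=> i; rewrite /t; case: fintype.split => j; [exact: XZ | exact: YZ].
move=> c; rewrite big_split_ord /=.
under eq_bigr do rewrite tl; under [X in _ + X]eq_bigr do rewrite tr.
move=> vw0.
have Xsum := sum_in X n (c \o lshift m) v X0 XL Xv.
have Ysum := sum_in Y m (c \o @rshift n m) w Y0 YL Yw.
have v0 : \sum_i (c (lshift m i))%:C *: v i = 0.
  apply: XY; split=> //; move/eqP: vw0; rewrite addr_eq0 => /eqP ->.
  by have := YL (- 1) _ _ Ysum Y0; rewrite addr0 rmorphN rmorph1 !scaleN1r.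
move: vw0; rewrite v0 add0r => w0 i.
case: (split_ordP i) => j ->; first exact: (vf _ v0).
exact: (wf _ w0).
Qed.

(** With fewer [u] than [v], the matrix of coordinates of [v] has a nonzero row
vector in its kernel, which is a linear relation between the [v]. *)
Lemma independent_size_le n (v : 'I_n -> E) m (u : 'I_m -> E) :
  independent_over (fun z : R[i] => z) v ->
  (forall j, exists a : 'I_m -> R[i], v j = \sum_k a k *: u k) -> (n <= m)%N.
Proof.
move=> vf vu; have [a va] := choice vu; rewrite leqNgt; apply/negP => mn.
pose A := \matrix_(j, k) a j k.
have /rowV0Pn[r /sub_kermxP rA /eqP r0] : kermx A != 0.
  by rewrite -mxrank_eq0 mxrank_ker -lt0n subn_gt0 (leq_ltn_trans (rank_leq_col A)).
apply: r0; apply/rowP => j; rewrite mxE; apply: (vf (fun j => r 0 j)).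
under eq_bigr do rewrite va scaler_sumr.
rewrite exchange_big big1 //= => k _.
under eq_bigr do rewrite scalerA; rewrite -scaler_suml.
move/rowP/(_ k) : rA; rewrite !mxE; under eq_bigr do rewrite mxE.
by move=> ->; rewrite scale0r.
Qed.

(** Every [x] of [X] is a complex combination of the fixed points [x + C x] and
['i (x - C x)].  So as long as a real independent family of fixed points has fewer
members than a complex independent family of [X], its real span misses some
fixed point, by which it can be extended. *)
Lemma complex_dim_le_fixed X (C : E -> E) :
  (forall (a : R[i]) x y, X x -> X y -> X (a *: x + y)) ->
  (forall (a : R[i]) x y, C (a *: x + y) = conjc a *: C x + C y) ->
  involutive C -> (forall x, X x -> X (C x)) ->
  (complex_dim X <= real_dim (X `&` [set x | C x = x]))%E.
Proof.
move=> XL CL CK XC; set F := _ `&` _; apply: dim_le => n v Xv vf.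
suff [u [Fu uf]] : exists u : 'I_n -> E,
    (forall i, F (u i)) /\ independent_over (real_complex R) u.
  exact: independent_in_le_dim Fu uf.
suff h m : (m <= n)%N -> exists u : 'I_m -> E,
    (forall i, F (u i)) /\ independent_over (real_complex R) u by exact: h.
elim: m => [_|m IH mn].
  have u (i : 'I_0) : E by case: i.
  by exists u; split => [[]|c _ []].
have [u [Fu uf]] := IH (ltnW mn).
have [[x [Fx xu]]|span] := pselect (exists x, F x /\
    forall c : 'I_m -> R, x <> \sum_i (c i)%:C *: u i).
  exists (fun i => oapp u x (unlift ord0 i)); split.
    by move=> i; case: unliftP => [j|] _ /=; [exact: Fu | exact: Fx].
  move=> c; rewrite big_ord_recl unlift_none /=.
  under eq_bigr do rewrite liftK /=.
  move=> cu; have c0 : c ord0 = 0.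
    apply: contra_notP (xu (fun i => - (c ord0)^-1 * c (lift ord0 i))) => /eqP c0.
    under eq_bigr do rewrite rmorphM -scalerA.
    rewrite -scaler_sumr; move/eqP: cu; rewrite addrC addr_eq0 => /eqP ->.
    by rewrite scalerN -scaleNr -rmorphN opprK scalerA -rmorphM mulVf // scale1r.
  move: cu; rewrite c0 scale0r add0r => /uf cu i.
  by case: (unliftP ord0 i) => [j|] ->.
have {}span x : F x -> exists c : 'I_m -> R, x = \sum_i (c i)%:C *: u i.
  move=> Fx; apply: contra_notP span => h; exists x; split=> // c xc.
  by apply: h; exists c.
have CD x y : C (x + y) = C x + C y.
  by have := CL 1 x y; rewrite !scale1r conjc1 scale1r.
have C0 : C 0 = 0 by apply: (addrI (C 0)); rewrite -CD !addr0.
have CZ a x : C (a *: x) = conjc a *: C x.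
  by have := CL a x 0; rewrite !addr0 C0 addr0.
have XD x y : X x -> X y -> X (x + y).
  by move=> ? ?; rewrite -[x]scale1r; exact: XL.
suff : (n <= m)%N by rewrite leqNgt mn.
apply: (independent_size_le (u := u) vf) => j.
have XZ a x : X x -> X (a *: x).
  move=> Xx; have -> : a *: x = (a - 1) *: x + x by rewrite scalerBl scale1r subrK.
  exact: XL.
have [p vp] : exists c : 'I_m -> R, v j + C (v j) = \sum_i (c i)%:C *: u i.
  by apply: span; split => /=; [apply: XD => //; exact: XC | rewrite CD CK addrC].
have [q vq] : exists c : 'I_m -> R,
    'i%C *: (v j - C (v j)) = \sum_i (c i)%:C *: u i.
  apply: span; split => /=.
    by apply: (XZ); apply: XD => //; rewrite -scaleN1r; apply: (XZ); exact: XC.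
  rewrite CZ CD -(scaleN1r (C (v j))) CZ CK rmorphN rmorph1 !scaleN1r.
  have -> : conjc 'i%C = - 'i%C :> R[i] by apply/eqP; rewrite eq_complex /= oppr0 !eqxx.
  by rewrite scaleNr -scalerN opprB.
exists (fun i => 2^-1 * ((p i)%:C - 'i%C * (q i)%:C)).
under eq_bigr do rewrite -scalerA; rewrite -scaler_sumr.
under eq_bigr do rewrite scalerBl -scalerA.
rewrite sumrB -scaler_sumr -vp -vq scalerA -expr2 sqr_i scaleN1r opprK.
rewrite addrACA subrr addr0 -mulr2n -[v j *+ 2]scaler_nat scalerA.
by rewrite mulVf ?scale1r ?pnatr_eq0.
Qed.

End Dimension.

(** * Unitaries and deficiency spaces *)

Section Unitary.
Local Open Scope complex_scope.
Context {R : realType} {E : hilbertType R}.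
Implicit Types (x y : E) (a z : R[i]).
Variable U : E -> E.
Hypothesis Uu : unitary U.

Lemma unitaryP a x y : U (a *: x + y) = a *: U x + U y.
Proof. by case: Uu. Qed.

Lemma unitaryD x y : U (x + y) = U x + U y.
Proof. by have := unitaryP 1 x y; rewrite !scale1r. Qed.

Lemma unitary0 : U 0 = 0.
Proof. by apply: (addrI (U 0)); rewrite -unitaryD !addr0. Qed.

Lemma unitaryZ a x : U (a *: x) = a *: U x.
Proof. by rewrite -[a *: x]addr0 unitaryP unitary0 addr0. Qed.

Lemma unitaryB x y : U (x - y) = U x - U y.
Proof. by rewrite -scaleN1r unitaryD unitaryZ scaleN1r. Qed.

Lemma unitary_dot x y : dot (U x) (U y) = dot x y.
Proof. by case: Uu. Qed.

Lemma unitary_onto y : exists x, y = U x.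
Proof. by case: Uu => _ _ /(_ y)[x <-]; exists x. Qed.

Lemma unitary_inj : injective U.
Proof.
move=> x y xy; apply/eqP; rewrite -subr_eq0; apply/eqP/dot_eq0.
by rewrite -unitary_dot unitaryB xy subrr dot0l.
Qed.

Lemma adjoint_unitary x y : adjoint (graph U) (x, y) <-> x = U y.
Proof.
split=> [Uxy|-> a w]; last by rewrite /graph /= => ->; rewrite unitary_dot.
apply/eqP; rewrite -subr_eq0; apply/eqP/dot_eq0.
have [a ea] := unitary_onto (x - U y).
rewrite {2}ea dotBl unitary_dot.
by have := Uxy a (U a) erefl; rewrite /= => ->; rewrite subrr.
Qed.

(** The kernel of [adjoint (BU U D) - z], see [ker_shift_adjoint_BU]. *)
Definition deficiency_space (D : set (E * E)) z : set E := [set x | D (U x, z *: x)].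

(** [U^*] is bounded with adjoint [U], so the adjoint of [U^* D] is [D U] on its
maximal domain. *)
Lemma ker_shift_adjoint_BU D z : adjoint D = D ->
  ker_shift (adjoint (BU U D)) z = deficiency_space D z.
Proof.
move=> Dadj.
have adjBU x y : adjoint (BU U D) (x, y) <-> D (U x, y).
  rewrite -[in X in _ <-> X]Dadj.
  split=> [h a b Dab /=|h a b [c Dac /adjoint_unitary ec] /=].
    have [c ec] := unitary_onto b; rewrite ec unitary_dot.
    by apply: h; exists b => //=; apply/adjoint_unitary.
  by move: Dac; rewrite /= ec -(unitary_dot x b); exact: h.
apply/seteqP; split => [x [y /adjBU Dxy /eqP]|x Dx].
  by rewrite subr_eq0 => /eqP yE; rewrite /deficiency_space /= -yE.
by exists (z *: x); [exact/adjBU | rewrite subrr].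
Qed.

End Unitary.

(** * Positive selfadjoint operators *)

Section PositiveOperator.
Local Open Scope complex_scope.
Context {R : realType} {E : hilbertType R}.
Implicit Types (x y u : E) (a z : R[i]).

Lemma imaginary_unit z : z = 'i%C \/ z = - 'i%C ->
  [/\ z * conjc z = 1, z + conjc z = 0 & ~~ (0 <= z)].
Proof.
have i0 : ~~ (0 <= 'i%C :> R[i]) by rewrite lecE /= oner_eq0.
have cc : (- 'i%C : R[i]) = conjc 'i%C.
  by apply/eqP; rewrite eq_complex /= oppr0 !eqxx.
case=> ->; rewrite ?cc ?conjcK ?conj_ge0; split=> //;
  by apply/eqP; rewrite eq_complex /=; apply/andP; split; apply/eqP; ring.
Qed.

Variable D : set (E * E).
Hypothesis Dpos : positive_selfadjoint D.

Lemma pos_linear a x y x' y' :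
  D (x, y) -> D (x', y') -> D (a *: x + x', a *: y + y').
Proof. by case: Dpos => -[_ + _] _ _ _; apply. Qed.

Lemma pos_add x y x' y' : D (x, y) -> D (x', y') -> D (x + x', y + y').
Proof. by move=> h /(pos_linear 1 h); rewrite !scale1r. Qed.

Lemma pos_scale a x y : D (x, y) -> D (a *: x, a *: y).
Proof.
move=> h; have [[D0 _ _] _ _ _] := Dpos.
by have := pos_linear a h D0; rewrite !addr0.
Qed.

Lemma pos_sub x y x' y' : D (x, y) -> D (x', y') -> D (x - x', y - y').
Proof. by move=> h /(pos_scale (- 1)); rewrite !scaleN1r; exact: pos_add. Qed.

Lemma pos_fun x y y' : D (x, y) -> D (x, y') -> y = y'.
Proof. by case: Dpos => -[_ _ +] _ _ _; apply. Qed.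

Lemma pos_adjoint : adjoint D = D.
Proof. by case: Dpos. Qed.

Lemma pos_sym x y x' y' : D (x, y) -> D (x', y') -> dot x y' = dot y x'.
Proof. by rewrite -{1}pos_adjoint => h; exact: h. Qed.

Lemma pos_ge0 x y : D (x, y) -> 0 <= dot x y.
Proof. by case: Dpos => _ _ _; apply. Qed.

Lemma pos_eigen z x : ~~ (0 <= z) -> D (x, z *: x) -> x = 0.
Proof.
move=> z0 /pos_ge0; rewrite dotZr => zx; apply: contrapT => /dot_gt0 x0.
by move: z0; rewrite -(pmulr_lge0 z x0) zx.
Qed.

Lemma pos_shift_surj z u : z * conjc z = 1 -> z + conjc z <= 0 -> ~~ (0 <= z) ->
  exists x, D (x, u + z *: x).
Proof.
move=> z1 z2 z0; apply: shift_surj.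
- by case: Dpos.
- by rewrite -pos_adjoint; exact: adjoint_closed.
- move=> x y Dxy; apply: shift_norm_ge => //.
  by rewrite -(pos_sym Dxy Dxy) -mulrDl mulr_le0_ge0 // pos_ge0.
- move=> w; rewrite pos_adjoint; apply: pos_eigen.
  by rewrite conj_ge0.
Qed.

End PositiveOperator.

(** * Modular data and endomorphisms *)

Section Modular.
Local Open Scope complex_scope.
Context {R : realType} {E : hilbertType R}.
Implicit Types (x y h k : E) (a z : R[i]).
Variables (H : set E) (J : E -> E) (Delta D : set (E * E)).
Hypotheses (Hst : standard_subspace H) (HJD : modular_data H J Delta D).

Let Dpos : positive_selfadjoint D.
Proof. by case: HJD => _ _ []. Qed.

Lemma conjugationP a x y : J (a *: x + y) = conjc a *: J x + J y.
Proof. by case: HJD => -[]. Qed.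

Lemma conjugationK x : J (J x) = x.
Proof. by case: HJD => -[_ _ ->]. Qed.

Lemma conjugation_dot x y : dot (J x) (J y) = dot y x.
Proof. by case: HJD => -[_ ->]. Qed.

Lemma conjugationZ a x : J (a *: x) = conjc a *: J x.
Proof.
have JD x' y : J (x' + y) = J x' + J y.
  by have := conjugationP 1 x' y; rewrite conjc1 !scale1r.
have J0 : J 0 = 0 by apply: (addrI (J 0)); rewrite -JD !addr0.
by have := conjugationP a x 0; rewrite !addr0 J0 addr0.
Qed.

(** [S = J D], with [J] moved to the other side. *)
Lemma tomitaE x y : tomita H (x, y) <-> D (x, J y).
Proof.
have [_ _ _ ->] := HJD; split=> [[w Dxw]|Dxy].
  by rewrite /graph /= => ->; rewrite conjugationK.
by exists (J y); rewrite //= /graph /= conjugationK.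
Qed.

(** [H] is the set of fixed points of the Tomita operator, since
[h1 + 'i h2 = h1 - 'i h2] forces [h2 = 0]. *)
Lemma mem_standardP h : H h <-> D (h, J h).
Proof.
have [[H0 _] _ _ _] := Hst; split=> [Hh|/tomitaE[h1 Hh1 [h2 Hh2 [/esym e1 e2]]]].
  by apply/tomitaE; exists h => //; exists 0 => //; rewrite scaler0 addr0 subr0.
move: e2; rewrite e1 => /addrI /eqP; rewrite eq_sym -addr_eq0 -mulr2n.
by rewrite -scaler_nat scaler_eq0 pnatr_eq0 /= => /eqP h20; rewrite h20 addr0.
Qed.

(** [J D J = D^-1], because the Tomita operator is its own inverse. *)
Lemma modular_conj x y : D (x, y) -> D (J y, J x).
Proof.
move=> Dxy; apply/tomitaE.
have [[H0 HL] _ _ _] := Hst.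
have : tomita H (x, J y) by apply/tomitaE; rewrite conjugationK.
move=> [h1 Hh1 [h2 Hh2 [<- <-]]]; exists h1 => //; exists (- h2).
  by have := HL (- 1) _ _ Hh2 H0; rewrite addr0 rmorphN rmorph1 scaleN1r.
by rewrite scalerN opprK.
Qed.

Lemma symmetric_wrtP U : unitary U -> symmetric_wrt J U ->
  forall x, J (U (J (U x))) = x.
Proof.
move=> Uu Us x; have : graph U (x, U x) by [].
rewrite Us /graph => -[y /= [w wE /(adjoint_unitary Uu) eyw] UxE].
by rewrite UxE conjugationK -eyw wE conjugationK.
Qed.

Section Endomorphism.
Variable U : E -> E.
Hypotheses (Uu : unitary U) (UH : U @` H `<=` H).
Hypothesis (JUJU : forall x, J (U (J (U x))) = x).

Lemma endo_conj_endo x : U (J (U x)) = J x.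
Proof. by rewrite -[RHS](congr1 J (JUJU x)) conjugationK. Qed.

(** [U] intertwines the Tomita operator [J D] with itself, and [J U J = U^*], so
[U^* D] is a restriction of [D U]: the operator [BU U D] is symmetric. *)
Lemma modular_endo x y : D (x, U y) -> D (U x, y).
Proof.
move=> Dxy; have : tomita H (x, J (U y)) by apply/tomitaE; rewrite conjugationK.
move=> [h1 Hh1 [h2 Hh2 [e1 e2]]]; rewrite -[y]conjugationK; apply/tomitaE.
exists (U h1); first by apply: UH; exists h1.
exists (U h2); first by apply: UH; exists h2.
by rewrite -(endo_conj_endo y) -e1 -e2 (unitaryB Uu) (unitaryD Uu) !(unitaryZ Uu).
Qed.

(** A conjugation of the deficiency space for [|z| = 1]: the antiunitary [J U]
converts [D U x = z x] into the same equation because [J D J = D^-1] and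
[conj z^-1 = z]. *)
Let deficiency_conj z x := conjc z *: J (U x).

Definition real_form z : set E :=
  U @` (deficiency_space U D z `&` [set x | deficiency_conj z x = x]).

Lemma real_form_subspace z : real_subspace (real_form z).
Proof.
have [[D0 _ _] _ _ _] := Dpos.
have J0 : J 0 = 0 by rewrite -[in LHS](scale0r (0 : E)) conjugationZ conjc0 scale0r.
split.
  exists 0; last exact: unitary0.
  by rewrite /deficiency_space /deficiency_conj /= (unitary0 Uu) J0 !scaler0.
move=> r _ _ [x [/= Dx ex] <-] [y [/= Dy ey] <-].
exists (r%:C *: x + y); last exact: (unitaryP Uu).
rewrite /deficiency_space /deficiency_conj /=; split.
  rewrite (unitaryP Uu) scalerDr scalerA mulrC -scalerA; exact: pos_linear.
rewrite (unitaryP Uu) conjugationP conjc_real scalerDr scalerA mulrC -scalerA.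
by rewrite -[in RHS]ex -[in RHS]ey.
Qed.

(** A fixed point [y] has [J U y = z y = D U y]; so both conditions on [h = U y] below
have the same right-hand side. *)
Lemma real_form_eigen z h : z * conjc z = 1 -> real_form z h ->
  exists2 y, h = U y & D (h, z *: y) /\ J h = z *: y.
Proof.
move=> z1 [y [Dy /= ey] <-]; exists y => //; split => //.
by rewrite -{2}ey /deficiency_conj scalerA z1 scale1r.
Qed.

Lemma real_form_sub z h : z * conjc z = 1 -> real_form z h -> H h.
Proof.
by move=> z1 /(real_form_eigen z1)[y _ [Dh Jh]]; apply/mem_standardP; rewrite Jh.
Qed.

(** [<h, U k> = <y, k> = <J k, J y> = z <D k, h> = z <k, D h> = z^2 <k, y>]. *)
Lemma real_form_dot z h k : z * conjc z = 1 -> real_form z h -> H k ->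
  dot h (U k) = z ^+ 2 * conjc (dot h (U k)).
Proof.
move=> z1 /(real_form_eigen z1)[y -> [Dh Jh]] /mem_standardP Dk.
rewrite (unitary_dot Uu).
have Jy : J y = z *: U y.
  by rewrite -[U y]conjugationK Jh conjugationZ scalerA z1 scale1r.
rewrite -{1}conjugation_dot Jy dotZr -(pos_sym Dpos Dk Dh) dotZr mulrA -expr2.
by rewrite -dot_conj.
Qed.

Lemma complex_dim_le_real_form z : z * conjc z = 1 ->
  (complex_dim (deficiency_space U D z) <= real_dim (real_form z))%E.
Proof.
move=> z1; apply: (@le_trans _ _ (real_dim
    (deficiency_space U D z `&` [set x | deficiency_conj z x = x]))).
  apply: complex_dim_le_fixed; rewrite /deficiency_conj /deficiency_space /=.
  - move=> a x y Dx Dy; rewrite (unitaryP Uu) scalerDr !scalerA [z * a]mulrC -scalerA.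
    exact: pos_linear.
  - move=> a x y; rewrite (unitaryP Uu) conjugationP scalerDr !scalerA.
    by rewrite [_ * conjc a]mulrC.
  - move=> x; rewrite (unitaryZ Uu) conjugationZ conjcK JUJU scalerA.
    by rewrite [_ * z]mulrC z1 scale1r.
  - move=> x /modular_conj /(pos_scale Dpos (conjc z)).
    rewrite (unitaryZ Uu) endo_conj_endo conjugationZ !scalerA => h.
    have := pos_scale Dpos z h; rewrite !scalerA.
    by rewrite mulrA z1 mul1r.
apply: (dim_le_injection (G := graph U)) => //=.
- by move=> a x y x' y'; rewrite /graph /= => -> ->; rewrite unitaryP.
- by rewrite /graph /= unitary0.
- by move=> x; rewrite /graph /= -{1}(unitary0 Uu) => /(unitary_inj Uu).
- by move=> x Dx; exists (U x) => //; exists x.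
Qed.

(** A closed symmetric operator with trivial deficiency spaces is selfadjoint; for
[B = BU U D] this says that [D U x = w] implies [D x = U w].  When [h = U x] is in
[H], the vector [w] is [J h], and the conclusion becomes [D x = J x]. *)
Lemma deficiency_trivial_onto : deficiency_space U D 'i%C `<=` [set 0] ->
  deficiency_space U D (- 'i%C) `<=` [set 0] -> H `<=` U @` H.
Proof.
move=> Ki0 Kni0.
(* The graph of [U^* D]. *)
pose B := [set p | D (p.1, U p.2)].
have Blin : linear_operator B.
  split => [|a x y x' y' Bxy Bxy'|x y y' Bxy Bxy'].
  - have [[D0 _ _] _ _ _] := Dpos; by rewrite /B /= (unitary0 Uu).
  - by rewrite /B /= (unitaryP Uu); exact: pos_linear.
  - by apply: (unitary_inj Uu); apply: (pos_fun Dpos) Bxy Bxy'.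
have Bsub w v : adjoint B (w, v) -> D (U w, v).
  move=> h; rewrite -(pos_adjoint Dpos) => a b Dab /=.
  have [c cb] := unitary_onto Uu b.
  by rewrite cb (unitary_dot Uu); apply: (h a); rewrite /B /= -cb.
(* [U^* D] is the adjoint of [D U]. *)
have Bcl : seq_closed_graph B.
  move=> u v x y Buv ux vy; rewrite /B /= -(pos_adjoint Dpos) => a b Dab /=.
  have [c cb] := unitary_onto Uu a; rewrite cb (unitary_dot Uu).
  pose T := [set p | D (U p.1, p.2)].
  suff : adjoint T (x, y) by apply; rewrite /T /= -cb.
  apply: (adjoint_closed (u := u) (v := v)) => // n d e Te /=.
  rewrite -(unitary_dot Uu (v n)); apply: (pos_sym Dpos (Buv n) Te).
have Bsurj u : exists x, D (x, U (u + (- 'i%C) *: x)).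
  have [i1 i2 _] := @imaginary_unit R _ (or_intror erefl).
  apply: (@shift_surj _ _ B) => //.
    move=> x y Bxy; apply: shift_norm_ge => //.
    have <- : dot x y = dot y x.
      by rewrite (pos_sym Dpos Bxy (modular_endo Bxy)) (unitary_dot Uu).
    by rewrite -mulrDl i2 mul0r.
  have -> : conjc (- 'i%C) = 'i%C :> R[i].
    by apply/eqP; rewrite -subr_eq0 addrC i2.
  by move=> w /Bsub; exact: Ki0.
have Bself x w : D (U x, w) -> D (x, U w).
  move=> Dxw; have [a Da] := Bsurj (w + 'i%C *: x).
  (* [a] solves [(B + i) a = w + i x], so [x - a] is in the kernel of [adjoint B + i]. *)
  suff /eqP : x - a = 0.
    rewrite subr_eq0 => /eqP xa; move: Da.
    by rewrite -xa scaleNr addrK.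
  apply: Kni0; rewrite /deficiency_space /= (unitaryB Uu).
  have := pos_sub Dpos Dxw (modular_endo Da).
  congr (D (_, _)).
  by rewrite !scaleNr scalerBr !opprB addrCA opprD [w + _]addrA subrr add0r.
move=> h /[dup] Hh /mem_standardP; have [x ->] := unitary_onto Uu h => /Bself.
by rewrite endo_conj_endo => /mem_standardP Hx; exists x.
Qed.

End Endomorphism.

Section Square.
Variable V : E -> E.
Hypotheses (Vu : unitary V) (VH : V @` H `<=` H).
Hypothesis (JVJV : forall x, J (V (J (V x))) = x).

(** In formulas, [a] is [(D - w)^-1 V x] and the image of [x] is
[y = V^* (V x + (w - z) a) = V^* (D - z) a].  Then [V^2 y = V^2 x + (w - z) V a] is
in the domain of [D], and [D V a = V^* D a] gives [D V^2 y = w y].  If [y = 0] then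
[D a = z a], so that [a = 0] and [x = 0]. *)
Lemma complex_dim_square_le z (w : R[i]) : w * conjc w = 1 -> w + conjc w <= 0 ->
  ~~ (0 <= w) -> ~~ (0 <= z) ->
  (complex_dim (deficiency_space (V \o V) D z) <=
   complex_dim (deficiency_space (V \o V) D w))%E.
Proof.
move=> w1 w2 w0 z0.
pose G := [set p : E * E | exists a : E,
  D (a, V p.1 + w *: a) /\ V p.2 = V p.1 + (w - z) *: a].
apply: (dim_le_injection (G := G)).
- move=> c x y x' y' [a [Da ya]] [a' [Da' ya']]; exists (c *: a + a') => /=.
  rewrite !(unitaryP Vu) ya ya' !scalerDr !scalerA; split.
    have := pos_linear Dpos c Da Da'.
    by rewrite /= scalerDr scalerA [c * w]mulrC addrACA.
  by rewrite [c * _]mulrC addrACA.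
- by exists 0; have [[D0 _ _] _ _ _] := Dpos; rewrite /= (unitary0 Vu) !scaler0 !addr0.
- move=> x [a [/= Da]]; rewrite (unitary0 Vu) => /esym/eqP.
  rewrite addr_eq0 -scaleNr opprB => /eqP Vx.
  have a0 : a = 0 by apply: (pos_eigen Dpos z0); move: Da; rewrite Vx -scalerDl subrK.
  by apply: (unitary_inj Vu); rewrite Vx a0 scaler0 (unitary0 Vu).
move=> x; rewrite /deficiency_space /= => Dx.
have [a Da] := pos_shift_surj Dpos (V x) w1 w2 w0.
have [y Vy] := unitary_onto Vu (V x + (w - z) *: a).
exists y; last by exists a.
have [b Vb] := unitary_onto Vu (V x + w *: a).
have DVa : D (V a, b).
  by apply: modular_endo => //; rewrite -Vb.
rewrite -Vy (unitaryD Vu) (unitaryZ Vu).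
have := pos_add Dpos Dx (pos_scale Dpos (w - z) DVa).
congr (D (_, _)); apply: (unitary_inj Vu).
rewrite (unitaryD Vu) !(unitaryZ Vu) -Vb -Vy !scalerDr !scalerA addrA -scalerDl.
by rewrite [w * _]mulrC [z + _]addrC subrK.
Qed.

End Square.
End Modular.

(** * Deficiency indices of endomorphisms *)

Local Open Scope ereal_scope.

Theorem corollary5p4 (R : realType) (E : hilbertType R) (H : set E)
    (J : E -> E) (Delta Dhalf : set (E * E)) (U : E -> E) :
  separable_space E ->
  standard_subspace H ->
  modular_data H J Delta Dhalf ->
  proper_endomorphism H U ->
  (symmetric_wrt J U ->
    deficiency_plus U Dhalf + deficiency_minus U Dhalf
      <= real_dim (real_orthogonal_complement (U @` H) `&` H) /\
    0 < deficiency_plus U Dhalf + deficiency_minus U Dhalf) /\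
  (forall V : E -> E, endomorphism H V -> symmetric_wrt J V -> U = V \o V ->
    [/\ deficiency_plus U Dhalf = deficiency_minus U Dhalf,
        deficiency_plus U Dhalf
          <= real_dim (symplectic_complement (U @` H) `&` H),
        0 < deficiency_plus U Dhalf &
        symplectic_complement (U @` H) `&` H <> [set 0%R : E]]).
Proof.
move=> _ Hst HJD [Uu [UH UnH]].
have Dpos : positive_selfadjoint Dhalf by case: HJD => _ _ [].
have [i1 i2 i0] := @imaginary_unit R _ (or_introl erefl).
have [ni1 ni2 ni0] := @imaginary_unit R _ (or_intror erefl).
rewrite /deficiency_plus /deficiency_minus.
rewrite !(ker_shift_adjoint_BU Uu _ (pos_adjoint Dpos)).
pose n z := complex_dim (deficiency_space U Dhalf z).
have deficiency_gt0 : (forall x, J (U (J (U x))) = x) ->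
    0 < n 'i%C \/ 0 < n (- 'i%C)%R.
  move=> JUJU; apply: contrapT => /not_orP[ni nni].
  apply: UnH; apply: (deficiency_trivial_onto Hst HJD Uu UH JUJU) => x Kx.
    by apply: contrapT => x0; apply: ni; exact: complex_dim_gt0 Kx x0.
  by apply: contrapT => x0; apply: nni; exact: complex_dim_gt0 Kx x0.
split.
  move=> /(symmetric_wrtP HJD Uu) JUJU; split; last first.
    case: (deficiency_gt0 JUJU) => n0; apply: (lt_le_trans n0).
      by rewrite leeDl ?dim_ge0.
    by rewrite leeDr ?dim_ge0.
  pose F := real_form J Dhalf U.
  have sub (z : R[i]) : (z * conjc z = 1)%R -> (z ^+ 2 = -1)%R ->
      F z `<=` real_orthogonal_complement (U @` H) `&` H.
    move=> z1 z2 h Fh; split; last exact: (real_form_sub Hst HJD z1 Fh).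
    move=> _ [k Hk <-].
    have := real_form_dot Hst HJD Uu z1 Fh Hk; rewrite z2 mulN1r.
    by case: (dot _ _) => a b [/eqP]; rewrite -addr_eq0 -mulr2n mulrn_eq0 => /eqP.
  apply: le_trans (leeD (complex_dim_le_real_form Hst HJD Uu JUJU i1)
                        (complex_dim_le_real_form Hst HJD Uu JUJU ni1)) _.
  apply: real_dim_add.
  - exact: (real_form_subspace HJD Uu).
  - exact: (real_form_subspace HJD Uu).
  - by apply: sub => //; exact: sqr_i.
  - by apply: sub => //; rewrite sqrrN sqr_i.
  move=> h [/(real_form_eigen i1)[y -> [Dy _]]].
  move=> /(real_form_eigen ni1)[y' /(unitary_inj Uu) <- [/(pos_fun Dpos Dy)+ _]].
  move=> /eqP; rewrite scaleNr -addr_eq0 -mulr2n -scaler_nat scalerA.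
  rewrite scaler_eq0 mulf_eq0 pnatr_eq0 eq_complex /= oner_eq0 andbF /= => /eqP ->.
  exact: unitary0.
move=> V [Vu VH] /(symmetric_wrtP HJD Vu) JVJV UV.
have JUJU x : J (U (J (U x))) = x.
  by rewrite UV /= (endo_conj_endo HJD JVJV) JVJV.
have eq_n : n 'i%C = n (- 'i%C)%R.
  apply/le_anti/andP; rewrite /n UV; split.
    by apply: (complex_dim_square_le HJD Vu VH JVJV ni1 _ ni0 i0); rewrite ni2.
  by apply: (complex_dim_square_le HJD Vu VH JVJV i1 _ i0 ni0); rewrite i2.
have n0 : 0 < n 'i%C by case: (deficiency_gt0 JUJU) => //; rewrite -eq_n.
have le_n : n 'i%C <= real_dim (symplectic_complement (U @` H) `&` H).
  have m1 : (-1 * conjc (-1) = 1 :> R[i])%R by rewrite rmorphN rmorph1 mulrNN mulr1.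
  apply: (@le_trans _ _ (n (- 1)%R)).
    rewrite /n UV; apply: (complex_dim_square_le HJD Vu VH JVJV m1) => //.
      by rewrite rmorphN rmorph1 -opprD oppr_le0 addr_ge0.
    by rewrite oppr_ge0 (lt_geF ltr01).
  apply: le_trans (complex_dim_le_real_form Hst HJD Uu JUJU m1) _.
  apply: le_dim => h Fh; split; last exact: (real_form_sub Hst HJD m1 Fh).
  move=> _ [k Hk <-].
  have := real_form_dot Hst HJD Uu m1 Fh Hk; rewrite sqrrN expr1n mul1r.
  by case: (dot _ _) => a b [/eqP]; rewrite -addr_eq0 -mulr2n mulrn_eq0 => /eqP.
split => // e.
have := lt_le_trans n0 le_n; rewrite ltNge => /negP; apply.
by apply: real_dim_le0 => x; rewrite e.
Qed.
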